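(* Let $\mathcal{P}$ be a finite set of propositional symbols and $\varphi$ an $\mathrm{LDL}_f$ formula over $\mathcal{P}$. Let $\mathsf{pref}_{\varphi}$ and $\mathsf{pref}_{\neg\varphi}$ be regular expressions over $2^{\mathcal{P}}$ (built from propositional formulae with $+$, $;$, $^*$, without tests) with $\mathcal{L}(\mathsf{pref}_{\varphi})=\mathcal{L}_{\mathit{poss\_good}}(\varphi)$ and $\mathcal{L}(\mathsf{pref}_{\neg\varphi})=\mathcal{L}_{\mathit{poss\_good}}(\neg\varphi)$. Then for every finite trace $\pi$: (1) $\pi\in\mathcal{L}_{\mathit{poss\_good}}(\varphi)$ iff $\pi\models\langle\mathsf{pref}_{\varphi}\rangle\mathit{end}$; (2) $\pi\in\mathcal{L}_{\mathit{nec\_good}}(\varphi)$ iff $\pi\models\langle\mathsf{pref}_{\varphi}\rangle\mathit{end}\wedge\neg\langle\mathsf{pref}_{\neg\varphi}\rangle\mathit{end}$.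
   Context: A trace is a finite, possibly empty, sequence $\pi=\pi_0,\dots,\pi_n$ of elements of $2^{\mathcal{P}}$; $\mathit{length}(\pi)=n+1$ ($0$ for the empty trace $\epsilon$), $\pi(i)=\pi_i$, and $\pi(i,j)=\pi_i,\dots,\pi_{j-1}$ (equal to $\pi(i,\mathit{length}(\pi))$ if $j>\mathit{length}(\pi)$, and to $\epsilon$ if $j\le i$). $\pi\pi'$ denotes concatenation of traces. $\mathrm{LDL}_f$ formulae and path expressions are given by $\varphi ::= \mathtt{true}\mid\mathtt{false}\mid\neg\varphi\mid\varphi_1\wedge\varphi_2\mid\varphi_1\vee\varphi_2\mid\langle\rho\rangle\varphi\mid[\rho]\varphi$ and $\rho ::= \phi\mid\varphi?\mid\rho_1+\rho_2\mid\rho_1;\rho_2\mid\rho^*$, where $\phi$ ranges over propositional formulae over $\mathcal{P}$. Semantics at position $i\ge 0$: $\pi,i\models\mathtt{true}$; $\pi,i\not\models\mathtt{false}$; Boolean connectives as usual; $\pi,i\models\langle\rho\rangle\varphi$ iff for some $j\ge i$, $\pi(i,j)\in\mathcal{L}(\rho)$ and $\pi,j\models\varphi$; $\pi,i\models[\rho]\varphi$ iff for all $j\ge i$ with $\pi(i,j)\in\mathcal{L}(\rho)$, $\pi,j\models\varphi$. Here $\pi(i,j)\in\mathcal{L}(\phi)$ iff $j=i+1$, $i<\mathit{length}(\pi)$ and $\pi(i)\models\phi$; $\pi(i,j)\in\mathcal{L}(\varphi?)$ iff $j=i$ and $\pi,i\models\varphi$; $\pi(i,j)\in\mathcal{L}(\rho_1+\rho_2)$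 iff it is in $\mathcal{L}(\rho_1)$ or $\mathcal{L}(\rho_2)$; $\pi(i,j)\in\mathcal{L}(\rho_1;\rho_2)$ iff for some $k$, $\pi(i,k)\in\mathcal{L}(\rho_1)$ and $\pi(k,j)\in\mathcal{L}(\rho_2)$; $\pi(i,j)\in\mathcal{L}(\rho^* )$ iff $j=i$ or for some $k$, $\pi(i,k)\in\mathcal{L}(\rho)$ and $\pi(k,j)\in\mathcal{L}(\rho^* )$. We write $\pi\models\varphi$ for $\pi,0\models\varphi$, and $\mathcal{L}(\varphi)=\{\pi\mid\pi\models\varphi\}$. The abbreviation $\mathit{end}$ stands for $[\mathit{true}]\mathtt{false}$ ($\mathit{true}$ the propositional tautology). For a test-free regular expression $\rho$, $\mathcal{L}(\rho)$ also denotes its usual language of finite traces (a propositional formula $\phi$ matches the one-letter traces $\Pi$ with $\Pi\models\phi$). Prefix languages: $\mathcal{L}_{\mathit{poss\_good}}(\varphi)=\{\pi\mid \exists\pi'.\ \pi\pi'\in\mathcal{L}(\varphi)\}$; $\mathcal{L}_{\mathit{nec\_good}}(\varphi)=\{\pi\mid \forall\pi'.\ \pi\pi'\in\mathcal{L}(\varphi)\}$ ($\pi'$ ranges over finite traces, including $\epsilon$). *)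

(* Defs.v *)
From Stdlib Require Import Relation_Operators.
From mathcomp Require Import all_boot.

Set Implicit Arguments.
Unset Strict Implicit.
Unset Printing Implicit Defensive.

(* An interpretation in 2^P is the set of the symbols that are true in it. *)
Definition trace (P : finType) := seq {set P}.

Inductive prop_form (P : finType) : Type :=
  | PTrue
  | PFalse
  | PAtom of P
  | PNot of prop_form P
  | PAnd of prop_form P & prop_form P
  | POr of prop_form P & prop_form P.

Arguments PTrue {P}.
Arguments PFalse {P}.

Fixpoint prop_sat (P : finType) (I : {set P}) (f : prop_form P) : bool :=
  match f with
  | PTrue => true
  | PFalse => false
  | PAtom p => p \in I
  | PNot f1 => ~~ prop_sat I f1
  | PAnd f1 f2 => prop_sat I f1 && prop_sat I f2
  | POr f1 f2 => prop_sat I f1 || prop_sat I f2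
  end.

Inductive ldlf (P : finType) : Type :=
  | LTrue
  | LFalse
  | LNot of ldlf P
  | LAnd of ldlf P & ldlf P
  | LOr of ldlf P & ldlf P
  | LDiamond of path_expr P & ldlf P
  | LBox of path_expr P & ldlf P
with path_expr (P : finType) : Type :=
  | EProp of prop_form P
  | ETest of ldlf P
  | EPlus of path_expr P & path_expr P
  | ESeq of path_expr P & path_expr P
  | EStar of path_expr P.

Arguments LTrue {P}.
Arguments LFalse {P}.

(* Because of tests, membership of pi(i, j) in the language of a path
   expression depends on pi, i and j and not only on the letters of the
   segment; [in_path pi rho i j] is that ternary relation. The clause for the
   star is recursive, and is read as a least fixpoint. *)
Fixpoint sat (P : finType) (pi : trace P) (phi : ldlf P) (i : nat) : Prop :=
  match phi with
  | LTrue => True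
  | LFalse => False
  | LNot f => ~ sat pi f i
  | LAnd f1 f2 => sat pi f1 i /\ sat pi f2 i
  | LOr f1 f2 => sat pi f1 i \/ sat pi f2 i
  | LDiamond r f => exists j, [/\ i <= j, in_path pi r i j & sat pi f j]
  | LBox r f => forall j, i <= j -> in_path pi r i j -> sat pi f j
  end
with in_path (P : finType) (pi : trace P) (rho : path_expr P) (i j : nat)
  : Prop :=
  match rho with
  | EProp f => [/\ j = i.+1, i < size pi & prop_sat (nth set0 pi i) f]
  | ETest f => j = i /\ sat pi f i
  | EPlus r1 r2 => in_path pi r1 i j \/ in_path pi r2 i j
  | ESeq r1 r2 => exists k, in_path pi r1 i k /\ in_path pi r2 k j
  | EStar r => clos_refl_trans_1n nat (in_path pi r) i j
  end.

Definition models (P : finType) (pi : trace P) (phi : ldlf P) : Prop :=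
  sat pi phi 0.

Definition ldl_end {P : finType} : ldlf P := LBox (EProp PTrue) LFalse.

Inductive regex (P : finType) : Type :=
  | RProp of prop_form P
  | RPlus of regex P & regex P
  | RSeq of regex P & regex P
  | RStar of regex P.

Fixpoint path_of_regex (P : finType) (r : regex P) : path_expr P :=
  match r with
  | RProp f => EProp f
  | RPlus r1 r2 => EPlus (path_of_regex r1) (path_of_regex r2)
  | RSeq r1 r2 => ESeq (path_of_regex r1) (path_of_regex r2)
  | RStar r1 => EStar (path_of_regex r1)
  end.

Inductive star_lang (P : finType) (L : trace P -> Prop) : trace P -> Prop :=
  | star_lang_nil : star_lang L [::]
  | star_lang_cat u v : L u -> star_lang L v -> star_lang L (u ++ v).

Fixpoint regex_lang (P : finType) (r : regex P) (pi : trace P) : Prop :=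
  match r with
  | RProp f => exists2 I, pi = [:: I] & prop_sat I f
  | RPlus r1 r2 => regex_lang r1 pi \/ regex_lang r2 pi
  | RSeq r1 r2 =>
      exists u v, [/\ pi = u ++ v, regex_lang r1 u & regex_lang r2 v]
  | RStar r1 => star_lang (regex_lang r1) pi
  end.

Definition poss_good (P : finType) (phi : ldlf P) (pi : trace P) : Prop :=
  exists pi', models (pi ++ pi') phi.

Definition nec_good (P : finType) (phi : ldlf P) (pi : trace P) : Prop :=
  forall pi', models (pi ++ pi') phi.

(* Main.v *)
Require Import Defs.
From mathcomp Require Import all_boot.
From Stdlib Require Import Relation_Operators Classical_Prop.

(** For a test-free expression, whether the segment [pi(i, j)] matches depends
    only on the letters of that segment. Since [end] holds at a position of [pi]
    exactly when that position is the end of the trace, [<r>end] defines the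
    language of [r]. Claim (2) follows from claim (1) for [phi] and [~ phi],
    because a trace is necessarily good for [phi] iff it is not possibly good
    for [~ phi]; the first conjunct is then implied by the empty continuation. *)

(** Induction on [r], with the context [a], [b] left general: in a concatenation or a star, the
    first factor is absorbed into the left context of the second. *)
Lemma regex_lang_in_path (P : finType) (r : regex P) (a u b : trace P) :
  regex_lang r u ->
  in_path (a ++ u ++ b) (path_of_regex r) (size a) (size a + size u).
Proof.
elim: r a u b => [f|r1 IH1 r2 IH2|r1 IH1 r2 IH2|r IH] a u b /=.
- case=> I -> fI; rewrite addn1 !size_cat /= nth_cat ltnn subnn /=.
  by split; rewrite // addnS ltnS leq_addr.
- by case=> [/IH1|/IH2]; [left|right].
- case=> v [w [-> /IH1 Hv /IH2 Hw]]; exists (size a + size v).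
  split; first by rewrite -catA.
  by have := Hw (a ++ v) b; rewrite !size_cat -!catA addnA.
- move=> Hu; elim: Hu a => {u} [|u v /IH Hu _ IHv] a.
    by rewrite addn0; apply: rt1n_refl.
  apply: (rt1n_trans _ _ _ (size a + size u)); first by rewrite -catA.
  by have := IHv (a ++ u); rewrite !size_cat -!catA addnA.
Qed.

Lemma take_drop_cat (T : Type) (s : seq T) (i k j : nat) :
  i <= k <= j -> drop i (take j s) = drop i (take k s) ++ drop k (take j s).
Proof.
case/andP=> /subnK <- /subnK <-.
rewrite -[drop (_ + i) _]take_drop -drop_drop addnA -!take_drop.
by rewrite [X in take X _]addnC takeD.
Qed.

(** The bound on [i] is required because a star relates every position to itself, even one past the
    end. The bound on [j] is proved alongside, since it lets the induction continue from an
    intermediate position [k]. *)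
Lemma in_path_regex_lang (P : finType) (r : regex P) (pi : trace P) (i j : nat) :
  i <= size pi -> in_path pi (path_of_regex r) i j ->
  [/\ i <= j, j <= size pi & regex_lang r (drop i (take j pi))].
Proof.
elim: r i j => [f|r1 IH1 r2 IH2|r1 IH1 r2 IH2|r IH] i j le_i /=.
- case=> -> lt_i fI; split=> //; exists (nth set0 pi i) => //.
  rewrite (take_nth set0) // -cats1 drop_cat size_takel // ltnn subnn.
  by rewrite drop0.
- by case=> [/IH1|/IH2] [] //; split=> //; [left|right].
- case=> k [/IH1[]// ik le_k H1 /IH2[]// kj le_j H2].
  split=> //; first exact: leq_trans kj.
  exists (drop i (take k pi)), (drop k (take j pi)); split=> //.
  by rewrite -take_drop_cat // ik.
- move=> H; elim: H le_i => {i j} [i|i k j Hik _ IHk] le_i.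
    split=> //; rewrite drop_oversize ?size_takel //; exact: star_lang_nil.
  have [ik le_k H1] := IH _ _ le_i Hik.
  have [kj le_j H2] := IHk le_k.
  split=> //; first exact: leq_trans kj.
  by rewrite (@take_drop_cat _ _ i k j) ?ik //; apply: star_lang_cat.
Qed.

Lemma sat_end (P : finType) (pi : trace P) (i : nat) :
  sat pi ldl_end i <-> size pi <= i.
Proof.
split=> [/= H|le_i j _ /= []]; last by rewrite ltnNge le_i.
(* If a letter remained at [i], the step to [i.+1] would match [PTrue] and force [LFalse]. *)
by rewrite leqNgt; apply/negP => lt_i; apply: (H i.+1).
Qed.

Lemma models_diamond_end (P : finType) (r : regex P) (pi : trace P) :
  models pi (LDiamond (path_of_regex r) ldl_end) <-> regex_lang r pi.
Proof.
split=> [[j [_ /in_path_regex_lang[]// _ _ Hr /sat_end le_j]]|Hr].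
  (* As [end] holds at [j], the matched segment is the whole trace. *)
  by move: Hr; rewrite drop0 take_oversize.
exists (size pi); split=> //; last exact/sat_end.
by have := @regex_lang_in_path _ _ [::] _ [::] Hr; rewrite /= cats0.
Qed.

Lemma nec_goodE (P : finType) (phi : ldlf P) (pi : trace P) :
  nec_good phi pi <-> ~ poss_good (LNot phi) pi.
Proof.
split=> [H [u]|H u]; first by apply; apply: H.
(* Classical: a continuation violating [phi] would witness [poss_good (LNot phi) pi]. *)
by apply: NNPP => Hu; apply: H; exists u.
Qed.

Lemma nec_good_poss_good (P : finType) (phi : ldlf P) (pi : trace P) :
  nec_good phi pi -> poss_good phi pi.
Proof. by move=> H; exists [::]; apply: H. Qed.

Theorem theorem2 (P : finType) (phi : ldlf P) (pref_phi pref_nphi : regex P)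
  (Hphi : forall t : trace P, regex_lang pref_phi t <-> poss_good phi t)
  (Hnphi : forall t : trace P, regex_lang pref_nphi t <-> poss_good (LNot phi) t)
  (pi : trace P) :
  (poss_good phi pi <->
     models pi (LDiamond (path_of_regex pref_phi) ldl_end)) /\
  (nec_good phi pi <->
     models pi (LAnd (LDiamond (path_of_regex pref_phi) ldl_end)
                     (LNot (LDiamond (path_of_regex pref_nphi) ldl_end)))).
Proof.
have E1 := iff_trans (models_diamond_end _ pref_phi pi) (Hphi pi).
have E2 := iff_trans (models_diamond_end _ pref_nphi pi) (Hnphi pi).
split; first exact: iff_sym.
split=> [H|[_ H]].
  split; first exact/E1/nec_good_poss_good.
  by move=> /E2; apply/nec_goodE.
by apply/nec_goodE => /E2.
Qed.
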